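(* Let $K=\mathbb{F}_q$ be a finite field. Let $\mathcal{G}$ be a bipartite simple graph with a perfect matching, labelled as in the context, let $\mathbb{X}\subseteq\mathbb{P}^{s-1}$ be the toric set parameterized by its edges, let $\mathbb{Y}\subseteq\mathbb{X}$ be the set defined in the context, and let $\theta:S\to R$ be the $K$-algebra map defined in the context. Then $$I_{\mathbb{Y}}=I_{\mathbb{X}}+\ker\theta.$$
   Context: Setting: $\mathcal{G}$ is a bipartite simple graph on vertices $v_1,\ldots,v_{2k}$ with $s$ edges, every edge joining a vertex of $\{v_1,v_3,\ldots,v_{2k-1}\}$ to a vertex of $\{v_2,v_4,\ldots,v_{2k}\}$, and $\{\{v_{2i-1},v_{2i}\}: i=1,\ldots,k\}$ is a perfect matching of $\mathcal{G}$. Let $n_i=\deg v_i$, so $n_1+n_3+\cdots+n_{2k-1}=s$. The edges are ordered in consecutive blocks: first the $n_1$ edges incident with $v_1$ (starting with $\{v_1,v_2\}$), then the $n_3$ edges incident with $v_3$ (starting with $\{v_3,v_4\}$), and so on, finally the $n_{2k-1}$ edges incident with $v_{2k-1}$ (starting with $\{v_{2k-1},v_{2k}\}$). With $K^*=K\setminus\{0\}$, the toric set parameterized by the edges is the set $\mathbb{X}\subseteq\mathbb{P}^{s-1}$ of all points, for $(t_1,\ldots,t_{2k})\in(K^* )^{2k}$, whose coordinate at the edge $\{v_j,v_l\}$ is $t_jt_l$ (coordinates ordered as the edges are: first the $n_1$ edges incident with $v_1$, then the $n_3$ edges incident with $v_3$, and so on, finally the $n_{2k-1}$ edges incident with $v_{2k-1}$,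 the block of $v_{2i-1}$ starting with the edge $\{v_{2i-1},v_{2i}\}$). Further $$\mathbb{Y}=\{[t_1,\ldots,t_1,t_3,\ldots,t_3,\ldots,t_{2k-1},\ldots,t_{2k-1}]\in\mathbb{P}^{s-1}: t_i\in K^*\},$$ where $t_i$ appears $n_i$ times for $i=1,3,\ldots,2k-1$. $S=K[X_1,\ldots,X_s]$ and $R=K[Y_1,Y_3,\ldots,Y_{2k-1}]$ are polynomial rings, and $\theta:S\to R$ is given by $f(X_1,\ldots,X_s)\mapsto f(Y_1,\ldots,Y_1,Y_3,\ldots,Y_3,\ldots,Y_{2k-1},\ldots,Y_{2k-1})$, where $Y_i$ appears $n_i$ times for $i=1,3,\ldots,2k-1$. The vanishing ideal $I_{\mathbb{Z}}\subseteq S$ of a set $\mathbb{Z}\subseteq\mathbb{P}^{s-1}$ is the ideal generated by the homogeneous polynomials vanishing at all points of $\mathbb{Z}$. *)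

(* Defs.v *)
From HB Require Import structures.
From mathcomp Require Import all_boot all_order all_algebra.
From mathcomp Require Import mpoly.

Set Implicit Arguments.
Unset Strict Implicit.
Unset Printing Implicit Defensive.

Import GRing.Theory.
Local Open Scope ring_scope.

(* The vertex v_j (1 <= j <= 2k) is the ordinal j - 1, so that for i : 'I_k,
   counted from 0, [vodd i] is v_{2i+1} and [veven i] is v_{2i+2}. *)
Fact vodd_subproof (k : nat) (i : 'I_k) : (2 * i < 2 * k)%N.
Proof. by rewrite ltn_pmul2l. Qed.

Fact veven_subproof (k : nat) (i : 'I_k) : ((2 * i).+1 < 2 * k)%N.
Proof. by rewrite !mul2n ltn_Sdouble. Qed.

Definition vodd (k : nat) (i : 'I_k) : 'I_(2 * k) :=
  Ordinal (vodd_subproof i).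

Definition veven (k : nat) (i : 'I_k) : 'I_(2 * k) :=
  Ordinal (veven_subproof i).

Definition edges (V : finType) (adj : rel V) : {set {set V}} :=
  [set [set p.1; p.2] | p : V * V & adj p.1 p.2].

Definition deg (V : finType) (adj : rel V) (v : V) : nat :=
  #|[set u | adj v u]|.

Definition ordered_in_blocks (k s : nat) (adj : rel 'I_(2 * k))
    (E : s.-tuple {set 'I_(2 * k)}) : Prop :=
  exists B : 'I_k -> seq {set 'I_(2 * k)},
    tval E = flatten [seq B i | i : 'I_k] /\
    forall i : 'I_k,
      [/\ uniq (B i),
          B i =i [set f in edges adj | vodd i \in f]
        & ohead (B i) = Some [set vodd i; veven i]].

(* x_0, ..., x_0, x_1, ..., x_1, ..., where x_i appears n_i times. *)
Definition repeat_blocks (T : Type) (k : nat) (n : 'I_k -> nat)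
    (x : 'I_k -> T) : seq T :=
  flatten [seq nseq (n i) (x i) | i : 'I_k].

(* The projective space P^{s-1} over K: the lines through 0 in K^s.  The point
   with homogeneous coordinates x is the line <[x]>; since lines have
   dimension 1, [is_point P x] forces x != 0. *)
Definition proj_space (K : fieldType) (s : nat) : Type :=
  {L : {vspace 'rV[K]_s} | \dim L == 1}.

Definition is_point (K : fieldType) (s : nat) (P : proj_space K s)
    (x : 'rV[K]_s) : Prop :=
  val P = <[x]>%VS.

Definition toric_set (K : fieldType) (k s : nat)
    (E : s.-tuple {set 'I_(2 * k)}) (P : proj_space K s) : Prop :=
  exists t : 'I_(2 * k) -> K,
    (forall j, t j != 0) /\
    is_point P (\row_(a < s) \prod_(j in tnth E a) t j).

Definition block_set (K : fieldType) (k s : nat) (n : 'I_k -> nat)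
    (P : proj_space K s) : Prop :=
  exists t : 'I_k -> K,
    (forall i, t i != 0) /\
    is_point P (\row_(a < s) nth 0 (repeat_blocks n t) a).

Definition theta (K : fieldType) (k s : nat) (n : 'I_k -> nat)
    (f : {mpoly K[s]}) : {mpoly K[k]} :=
  f \mPo [tuple nth 0 (repeat_blocks n (fun i : 'I_k => 'X_i)) a | a < s].

Definition ideal_gen (A : pzRingType) (G : A -> Prop) (f : A) : Prop :=
  exists (m : nat) (c g : 'I_m -> A),
    (forall i, G (g i)) /\ f = \sum_(i < m) c i * g i.

Definition ideal_sum (A : pzRingType) (I J : A -> Prop) (f : A) : Prop :=
  exists g h : A, [/\ I g, J h & f = g + h].

Definition kernel (A B : nmodType) (phi : A -> B) (f : A) : Prop :=
  phi f = 0.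

Definition vanishes_at (K : fieldType) (s : nat) (f : {mpoly K[s]})
    (P : proj_space K s) : Prop :=
  forall x : 'rV[K]_s, is_point P x -> f.@[fun a => x 0 a] = 0.

Definition vanishing_ideal (K : fieldType) (s : nat)
    (Z : proj_space K s -> Prop) : {mpoly K[s]} -> Prop :=
  ideal_gen (fun f : {mpoly K[s]} =>
    (exists d : nat, f \is d.-homog) /\ forall P, Z P -> vanishes_at f P).

(* Main.v *)
Require Import Defs.
From HB Require Import structures.
From mathcomp Require Import all_boot all_order all_algebra.
From mathcomp Require Import mpoly.

Set Implicit Arguments.
Unset Strict Implicit.
Unset Printing Implicit Defensive.

Import GRing.Theory.
Local Open Scope ring_scope.

(* Let sigma : R -> S send Y_i to the variable of the matching edge
   {v_i, v_{i+1}}; it is a section of theta.  If f is homogeneous and vanishes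
   on Y, then sigma (theta f) is homogeneous, and its value at x is the value
   of f at the point of Y whose i-th block repeats the coordinate of x at the
   i-th matching edge.  All coordinates of a point of X are nonzero, so
   sigma (theta f) lies in I_X, while f - sigma (theta f) lies in ker theta.
   Conversely Y is contained in X, and an f in ker theta equals
   f - sigma (theta f), a combination of the homogeneous binomials
   X^m - sigma (theta X^m), which vanish on Y. *)

(** * Substitution of variables along a map of indices *)

Section Rename.
Variable R : comNzRingType.

(** Both [theta] and its section sigma have this form, so identities between their composites reduce
    to identities between maps of indices. *)
Definition mrename (n r : nat) (h : 'I_n -> 'I_r) (p : {mpoly R[n]}) :
  {mpoly R[r]} := p \mPo [tuple 'X_(h i) | i < n].

Lemma mrename_linear (n r : nat) (h : 'I_n -> 'I_r) : linear (mrename h).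
Proof. by move=> c p q; rewrite /mrename linearP. Qed.

HB.instance Definition _ (n r : nat) (h : 'I_n -> 'I_r) :=
  GRing.isLinear.Build R _ _ _ (mrename h) (mrename_linear h).

Lemma mrenameE (n r : nat) (h : 'I_n -> 'I_r) (p : {mpoly R[n]}) :
  mrename h p = \sum_(m <- msupp p) p@_m *: mrename h 'X_[m].
Proof. exact: comp_mpolyEX. Qed.

Lemma mrenameX (n r : nat) (h : 'I_n -> 'I_r) (m : 'X_{1..n}) :
  mrename h 'X_[m] = \prod_i 'X_(h i) ^+ m i.
Proof.
by rewrite /mrename comp_mpolyX; apply: eq_bigr => i _; rewrite tnth_mktuple.
Qed.

Lemma mrenameM (n r : nat) (h : 'I_n -> 'I_r) : {morph mrename h : p q / p * q}.
Proof. by move=> p q; rewrite /mrename rmorphM. Qed.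

Lemma mrename_comp (n r t : nat) (h : 'I_n -> 'I_r) (g : 'I_r -> 'I_t)
    (p : {mpoly R[n]}) : mrename g (mrename h p) = mrename (g \o h) p.
Proof.
rewrite (mrenameE h) (mrenameE (g \o h)) (linear_sum (mrename g)) /=.
apply: eq_bigr => m _; rewrite linearZ /=; congr (_ *: _).
rewrite !mrenameX /mrename rmorph_prod.
apply: eq_bigr => i _; rewrite rmorphXn /= comp_mpolyXU.
by rewrite -tnth_nth tnth_mktuple.
Qed.

Lemma eq_mrename (n r : nat) (h g : 'I_n -> 'I_r) :
  h =1 g -> mrename h =1 mrename g.
Proof.
by move=> hg p; congr (_ \mPo _); apply: eq_from_tnth => i; rewrite !tnth_mktuple hg.
Qed.

Lemma meval_mrename (n r : nat) (h : 'I_n -> 'I_r) (p : {mpoly R[n]})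
    (v : 'I_r -> R) : (mrename h p).@[v] = p.@[v \o h].
Proof.
rewrite comp_mpoly_meval; apply: meval_eq => i.
by rewrite tnth_mktuple mevalXU.
Qed.

(** Each variable goes to a single variable, so the total degree of a monomial is kept even when [h]
    identifies indices. *)
Lemma mrename_homog (n r d : nat) (h : 'I_n -> 'I_r) (p : {mpoly R[n]}) :
  p \is d.-homog -> mrename h p \is d.-homog.
Proof.
move=> /dhomogP hp; rewrite mrenameE big_seq.
apply: rpred_sum => m /hp <-; apply: rpredZ; rewrite mrenameX.
under eq_bigr do rewrite mpolyXn.
rewrite mprodXE dhomogX /= mdeg_sum mdegE; apply/eqP; apply: eq_bigr => i _.
by rewrite mdegMn mdeg1 mul1n.
Qed.

End Rename.

(** * Ideals generated by a predicate *)

Section Ideals.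
Variable A : pzRingType.

Lemma ideal_gen_sum (G : A -> Prop) (m : nat) (c g : 'I_m -> A) :
  (forall i, G (g i)) -> ideal_gen G (\sum_(i < m) c i * g i).
Proof. by move=> Gg; exists m, c, g. Qed.

Lemma ideal_genD (G : A -> Prop) (x y : A) :
  ideal_gen G x -> ideal_gen G y -> ideal_gen G (x + y).
Proof.
move=> [m [c [g [Gg ->]]]] [l [d [h [Gh ->]]]].
exists (m + l)%N, (fun i => match split i with inl j => c j | inr j => d j end),
  (fun i => match split i with inl j => g j | inr j => h j end).
split=> [i|]; first by case: (split i).
rewrite big_split_ord /=; congr (_ + _); apply: eq_bigr => i _.
  by rewrite (unsplitK (inl i)).
by rewrite (unsplitK (inr i)).
Qed.

Lemma ideal_gen_sub (G H : A -> Prop) (x : A) :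
  (forall y, G y -> H y) -> ideal_gen G x -> ideal_gen H x.
Proof.
by move=> GH [m [c [g [Gg ->]]]]; apply: ideal_gen_sum => i; apply/GH/Gg.
Qed.

End Ideals.

(** * Incident edges and homogeneous coordinates *)

Lemma card_incident_edges (V : finType) (adj : rel V) (v : V) :
  ssrbool.symmetric adj -> irreflexive adj ->
  #|[set e in edges adj | v \in e]| = deg adj v.
Proof.
move=> adj_sym adj_irr.
have -> : [set e in edges adj | v \in e] = [set [set v; u] | u in [set u | adj v u]].
  apply/setP => e; rewrite inE; apply/andP/imsetP.
    case=> /imsetP[[a b]]; rewrite inE /= => ab ->; rewrite !inE.
    case/orP=> /eqP ->; first by exists b; rewrite ?inE.
    by exists a; rewrite ?inE 1?adj_sym // setUC.
  case=> u; rewrite inE => vu ->; split; last by rewrite !inE eqxx.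
  by apply/imsetP; exists (v, u); rewrite ?inE.
(* The map sending u to {v, u} is injective on neighbours of v: the only other case, u = v, would be
   a loop. *)
rewrite card_in_imset // => u w; rewrite !inE => vu vw euw.
have : u \in [set v; w] by rewrite -euw !inE eqxx orbT.
rewrite !inE => /orP[/eqP uv|/eqP //].
by rewrite uv adj_irr in vu.
Qed.

Lemma is_point_ex (K : fieldType) (s : nat) (x : 'rV[K]_s) :
  x != 0 -> exists P : proj_space K s, is_point P x.
Proof.
move=> x0; have dx : \dim <[x]> == 1 by rewrite dim_vline x0.
by exists (Sub <[x]>%VS dx).
Qed.

Lemma is_point_scale (K : fieldType) (s : nat) (P : proj_space K s)
    (x y : 'rV[K]_s) :
  is_point P x -> is_point P y -> exists2 c : K, c != 0 & y = c *: x.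
Proof.
move=> Px Py; have : y \in <[x]>%VS by rewrite -Px Py memv_line.
case/vlineP=> c yE; exists c => //; apply/eqP => c0.
by have := valP P; rewrite Py dim_vline yE c0 scale0r eqxx.
Qed.

(** * Edge blocks and matching edges *)

Section BipartiteBlocks.
Variables (k s : nat) (adj : rel 'I_(2 * k)) (E : s.-tuple {set 'I_(2 * k)}).
Hypothesis k_gt0 : (0 < k)%N.
Hypothesis adj_sym : ssrbool.symmetric adj.
Hypothesis adj_irr : irreflexive adj.
Hypothesis adj_bip : forall u v : 'I_(2 * k), adj u v -> odd u != odd v.
Hypothesis E_blocks : ordered_in_blocks adj E.

Let n (i : 'I_k) := deg adj (vodd i).

(** Ordinals are the vertex labels shifted by one, so odd-labelled vertices have even ordinals. *)
Lemma odd_vodd (i : 'I_k) : odd (vodd i) = false.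
Proof. by rewrite /= oddM. Qed.

Lemma vodd_inj : injective (@vodd k).
Proof. by move=> i j /(congr1 val) /= /eqP; rewrite eqn_pmul2l // => /eqP/val_inj. Qed.

Lemma edge_vodd (e : {set 'I_(2 * k)}) (i : 'I_k) :
  e \in edges adj -> vodd i \in e ->
  exists2 u : 'I_(2 * k), odd u & e = [set vodd i; u].
Proof.
case/imsetP=> [[a b]]; rewrite inE /= => /adj_bip ab ->.
rewrite !inE => /orP[] /eqP iE; rewrite -iE odd_vodd in ab *.
  by exists b => //; case: (odd b) ab.
by exists a; rewrite 1?setUC //; case: (odd a) ab.
Qed.

Lemma edge_vodd_inj (e : {set 'I_(2 * k)}) (i j : 'I_k) :
  e \in edges adj -> vodd i \in e -> vodd j \in e -> i = j.
Proof.
move=> eE /(edge_vodd eE)[u u_odd ->]; rewrite !inE.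
case/orP=> /eqP ij; first by apply/esym/vodd_inj.
by rewrite -ij odd_vodd in u_odd.
Qed.

(** The default [Ordinal k_gt0] only makes the function total: every member of [E] contains exactly
    one [vodd i]. *)
Definition block_index (e : {set 'I_(2 * k)}) : 'I_k :=
  odflt (Ordinal k_gt0) [pick i | vodd i \in e].

Lemma block_indexE (e : {set 'I_(2 * k)}) (i : 'I_k) :
  e \in edges adj -> vodd i \in e -> block_index e = i.
Proof.
move=> eE ie; rewrite /block_index; case: pickP => [j je|/(_ i)].
  exact: edge_vodd_inj je ie.
by rewrite ie.
Qed.

Lemma edge_order_incident (e : {set 'I_(2 * k)}) :
  e \in E -> e \in edges adj /\ exists i, vodd i \in e.
Proof.
case: E_blocks => B [EE HB]; rewrite memtE EE => /flattenP[b /mapP[i _ ->]].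
by have [_ -> _] := HB i; rewrite inE => /andP[eE ie]; split=> //; exists i.
Qed.

(** Block [B i] lists the edges at [vodd i] without repetition, so its length is [n i], and
    [block_index] is constantly [i] on it. *)
Lemma repeat_blocksE (T : Type) (x : 'I_k -> T) :
  repeat_blocks n x = [seq x (block_index e) | e <- E].
Proof.
case: E_blocks => B [-> HB]; rewrite /repeat_blocks map_flatten -map_comp.
congr flatten; apply: eq_map => i /=; have [Bu BE _] := HB i.
have <- : size (B i) = n i.
  by rewrite /n -card_incident_edges // -(card_uniqP Bu); apply: eq_card.
transitivity [seq x i | _ <- B i]; first by elim: (B i) => //= _ l ->.
apply/eq_in_map => e; rewrite BE inE => /andP[eE ie].
by rewrite (block_indexE eE ie).
Qed.

Definition block_of (a : 'I_s) : 'I_k := block_index (tnth E a).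

Lemma nth_repeat_blocks (T : Type) (x0 : T) (x : 'I_k -> T) (a : 'I_s) :
  nth x0 (repeat_blocks n x) a = x (block_of a).
Proof.
rewrite repeat_blocksE (nth_map (tnth E a)) ?size_tuple //.
by rewrite -tnth_nth.
Qed.

Lemma matching_edge_ex (i : 'I_k) : exists a, tnth E a == [set vodd i; veven i].
Proof.
have : [set vodd i; veven i] \in E.
  case: E_blocks => B [EE HB]; have [_ _ oh] := HB i; rewrite memtE EE.
  apply/flattenP; exists (B i); first by apply: map_f; rewrite mem_enum.
  by case: (B i) oh => // e l [->]; rewrite mem_head.
by case/tnthP=> a ->; exists a.
Qed.

Definition matching_edge (i : 'I_k) : 'I_s := xchoose (matching_edge_ex i).

(** At the level of indices, this says that sigma is a section of [theta]. *)
Lemma matching_edgeK : cancel matching_edge block_of.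
Proof.
move=> i; rewrite /block_of; have /eqP eE := xchooseP (matching_edge_ex i).
have [edgeE _] := edge_order_incident (mem_tnth (matching_edge i) E).
by apply: block_indexE => //; rewrite eE !inE eqxx.
Qed.

Lemma tnth_edge (a : 'I_s) :
  exists2 u : 'I_(2 * k), odd u & tnth E a = [set vodd (block_of a); u].
Proof.
have [eE [i ie]] := edge_order_incident (mem_tnth a E).
by rewrite /block_of (block_indexE eE ie); apply: edge_vodd.
Qed.

(** * The retraction and the two vanishing ideals *)

Variable K : fieldType.

Lemma thetaE (f : {mpoly K[s]}) : theta n f = mrename block_of f.
Proof.
rewrite /theta /mrename; congr (_ \mPo _); apply: eq_from_tnth => a.
by rewrite !tnth_mktuple nth_repeat_blocks.
Qed.

(** The composite of [theta] with sigma, which replaces each variable by that of the matching edge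
    in its block. *)
Definition retract (f : {mpoly K[s]}) : {mpoly K[s]} :=
  mrename matching_edge (theta n f).

Lemma retractE (f : {mpoly K[s]}) :
  retract f = mrename (matching_edge \o block_of) f.
Proof. by rewrite /retract thetaE mrename_comp. Qed.

Lemma theta_retract (f : {mpoly K[s]}) : theta n (retract f) = theta n f.
Proof.
rewrite retractE !thetaE mrename_comp; apply: eq_mrename => a.
by rewrite /= matching_edgeK.
Qed.

Lemma block_rowE (t : 'I_k -> K) :
  \row_(a < s) nth 0 (repeat_blocks n t) a = \row_(a < s) t (block_of a).
Proof. by apply/rowP => a; rewrite !mxE nth_repeat_blocks. Qed.

Lemma block_set_toric (P : proj_space K s) : block_set n P -> toric_set E P.
Proof.
move=> [t [t0]]; rewrite block_rowE => Pt.
(* With weight 1 at the vertices [veven i], an edge product reduces to the parameter of its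
   block. *)
pose w (j : 'I_(2 * k)) := if [pick i | vodd i == j] is Some i then t i else 1.
exists w; split=> [j|]; first by rewrite /w; case: pickP => // _; exact: oner_neq0.
suff -> : \row_a \prod_(j in tnth E a) w j = \row_a t (block_of a) by [].
apply/rowP => a; rewrite !mxE; have [u u_odd ->] := tnth_edge a.
have ou : vodd (block_of a) != u.
  by apply/eqP => ou; rewrite -ou odd_vodd in u_odd.
rewrite big_setU1 ?inE //= big_set1.
have -> : w u = 1.
  by rewrite /w; case: pickP => // i /eqP ui; rewrite -ui odd_vodd in u_odd.
rewrite mulr1 /w; case: pickP => [i /eqP/vodd_inj -> //|/(_ (block_of a))].
by rewrite eqxx.
Qed.

(** Any representative is a nonzero multiple of the vector of edge products of nonzero
    parameters. *)
Lemma toric_set_neq0 (P : proj_space K s) (x : 'rV[K]_s) :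
  toric_set E P -> is_point P x -> forall a, x 0 a != 0.
Proof.
move=> [t [t0 Pt]] Px a; have [c c0 ->] := is_point_scale Pt Px.
by rewrite !mxE mulf_neq0 //; apply/prodf_neq0 => j _.
Qed.

Lemma retract_vanishes (f : {mpoly K[s]}) :
  (forall P, block_set n P -> vanishes_at f P) ->
  forall P, toric_set E P -> vanishes_at (retract f) P.
Proof.
move=> fY P PX x Px; rewrite retractE meval_mrename.
have x0 := toric_set_neq0 PX Px.
pose y : 'rV[K]_s := \row_a x 0 (matching_edge (block_of a)).
(* Only a nonzero vector spans a projective point; [k_gt0] supplies a coordinate at which to test
   [y]. *)
have y0 : y != 0.
  apply/eqP => /rowP/(_ (matching_edge (Ordinal k_gt0))); rewrite !mxE => /eqP.
  by apply/negP/x0.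
have [Q Qy] := is_point_ex y0.
have QY : block_set n Q.
  by exists (fun i => x 0 (matching_edge i)); split=> [i|] //; rewrite block_rowE.
rewrite -(fY _ QY _ Qy); apply: meval_eq => a.
by rewrite mxE.
Qed.

(** Coordinates of a point of Y are constant on blocks, so reading them at the matching edges
    changes nothing. *)
Lemma retract_block_set (f : {mpoly K[s]}) (P : proj_space K s) :
  block_set n P -> vanishes_at (f - retract f) P.
Proof.
move=> [t [t0]]; rewrite block_rowE => Pt x Px; have [c _ ->] := is_point_scale Pt Px.
rewrite mevalB retractE meval_mrename; apply/eqP; rewrite subr_eq0; apply/eqP.
by apply: meval_eq => a; rewrite /= !mxE matching_edgeK.
Qed.

Lemma retract_homog (d : nat) (f : {mpoly K[s]}) :
  f \is d.-homog -> retract f \is d.-homog.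
Proof. by rewrite retractE; apply: mrename_homog. Qed.

Lemma kernel_sub_vanishing (f : {mpoly K[s]}) :
  kernel (@theta K k s n) f -> vanishing_ideal (@block_set K k s n) f.
Proof.
move=> f0; have rf0 : retract f = 0 by rewrite /retract f0 linear0.
(* Since [f] may be inhomogeneous, [retract f = 0] is subtracted monomial by monomial to exhibit
   homogeneous generators. *)
have -> : f = \sum_(m <- msupp f) (f@_m)%:MP * ('X_[m] - retract 'X_[m]).
  rewrite -[LHS]subr0 -[X in _ - X]rf0 retractE mrenameE {1}[f]mpolyE -sumrB.
  by apply: eq_bigr => m _; rewrite mul_mpolyC scalerBr retractE.
rewrite big_tnth; apply: ideal_gen_sum => i; set m := tnth _ _; split; last first.
  by move=> P; apply: retract_block_set.
exists (mdeg m); apply: rpredB; last apply: retract_homog; by rewrite dhomogX.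
Qed.

Lemma block_vanishing_ideal_split (f : {mpoly K[s]}) :
  vanishing_ideal (@block_set K k s n) f ->
  ideal_sum (vanishing_ideal (@toric_set K k s E)) (kernel (@theta K k s n)) f.
Proof.
move=> [l [c [g [gY ->]]]].
(* Splitting each generator and keeping the coefficients [c i] makes the first sum a combination of
   homogeneous elements; the second dies under [theta] by multiplicativity. *)
exists (\sum_(i < l) c i * retract (g i)), (\sum_(i < l) c i * (g i - retract (g i))).
split.
- apply: ideal_gen_sum => i; have [[d gd] gv] := gY i; split.
    by exists d; apply: retract_homog.
  exact: retract_vanishes.
- rewrite /kernel thetaE (linear_sum (mrename block_of)) big1 // => i _ /=.
  by rewrite mrenameM linearB /= -!thetaE theta_retract subrr mulr0.
- by rewrite -big_split; apply: eq_bigr => i _; rewrite /= -mulrDr addrC subrK.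
Qed.

End BipartiteBlocks.

Theorem proposition4p3 (K : finFieldType) (k s : nat)
    (adj : rel 'I_(2 * k)) (E : s.-tuple {set 'I_(2 * k)})
    (k_gt0 : (0 < k)%N)
    (adj_sym : ssrbool.symmetric adj)
    (adj_irr : irreflexive adj)
    (adj_bip : forall u v : 'I_(2 * k), adj u v -> odd u != odd v)
    (adj_matching : forall i : 'I_k, adj (vodd i) (veven i))
    (E_blocks : ordered_in_blocks adj E) :
  let n := fun i : 'I_k => deg adj (vodd i) in
  forall f : {mpoly K[s]},
    vanishing_ideal (@block_set K k s n) f <->
    ideal_sum (vanishing_ideal (@toric_set K k s E))
              (kernel (@theta K k s n)) f.
Proof.
move=> n f; split; first exact: block_vanishing_ideal_split.
move=> [g [h [gX hker ->]]]; apply: ideal_genD; last first.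
  exact: (kernel_sub_vanishing k_gt0 adj_sym adj_irr adj_bip E_blocks).
(* Since Y lies in X, each generator of the ideal of X is one for Y. *)
apply: ideal_gen_sub gX => p [p_homog pX]; split=> // P PY.
exact/pX/(block_set_toric k_gt0 adj_sym adj_irr adj_bip E_blocks).
Qed.
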